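(* Let $\mathbb{K}$ be a field, $S=\mathbb{K}[x_1,\ldots,x_n]$, and let $I_1,\dots,I_r$ be strongly stable ideals of $S$ such that, for each $i$, the set of minimal monomial generators $\{u_{i,1},\dots,u_{i,s_i}\}$ of $I_i$ consists of monomials of one common degree $d_i$ (the $d_i$ may differ). Let $R=S[T_{i,j}: 1\le i\le r,\ 1\le j\le s_i]$ and $R'=\mathbb{K}[T_{i,j}: 1\le i\le r,\ 1\le j\le s_i]$. If $\mathcal{G}'$ is a Gröbner basis for the toric ideal $T(I_1\oplus\cdots\oplus I_r)\subseteq R'$ with respect to a monomial order $\tau'$ on $R'$, then $$\mathcal{G}:=\left\{\underline{x_iT_{l,k}}-x_jT_{l,k'} \ :\ i<j \text{ and } x_iu_{l,k}=x_ju_{l,k'}\right\}\cup\mathcal{G}'$$ is a Gröbner basis for the defining ideal $\mathcal{L}$ of the multi-Rees algebra $\mathcal{R}(I_1\oplus\cdots\oplus I_r)$ with respect to an extended monomial order $\tau$ on $R$, i.e. a monomial order $\tau$ on $R$ with $\tau|_{R'}=\tau'$ (the underlined terms being the initial terms).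
   Context: A monomial ideal $I\subseteq S$ is strongly stable if for each monomial $m\in I$ one has $x_j\frac{m}{x_i}\in I$ whenever $x_i$ divides $m$ and $j<i$. The generators of $I_i$ are listed so that $u_{i,1}\succ_{rlex}\cdots\succ_{rlex}u_{i,s_i}$ in graded reverse lexicographic order with $x_1>\cdots>x_n$. The multi-Rees algebra is $\mathcal{R}(I_1\oplus\cdots\oplus I_r)=\bigoplus_{(a_1,\ldots,a_r)\in\mathbb{Z}_{\ge0}^r} I_1^{a_1}\cdots I_r^{a_r}t_1^{a_1}\cdots t_r^{a_r}\subseteq S[t_1,\dots,t_r]$; its defining ideal is $\mathcal{L}=\ker(\varphi)$, where $\varphi:R\to S[t_1,\dots,t_r]$ is the $S$-algebra homomorphism with $\varphi(T_{i,j})=u_{i,j}t_i$. The toric ideal $T(I_1\oplus\cdots\oplus I_r)$ is the kernel of the induced $\mathbb{K}$-algebra homomorphism $\varphi':R'\to\mathbb{K}[u_{i,j}t_i]$, $T_{i,j}\mapsto u_{i,j}t_i$ (the defining ideal of the special fiber ring). *)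

(* Defs.v *)
From mathcomp Require Import all_boot all_order all_algebra.
From mathcomp Require Export mpoly.

Set Implicit Arguments.
Unset Strict Implicit.
Unset Printing Implicit Defensive.

Import GRing.Theory.

Local Open Scope ring_scope.

Definition ideal_gen (A : comNzRingType) (E : A -> Prop) (p : A) : Prop :=
  exists s : seq (A * A),
    (forall c, c \in s -> E c.2) /\ p = \sum_(c <- s) c.1 * c.2.

(* [le m1 m2] reads "m1 is smaller than or equal to m2". *)
Definition monomial_order (n : nat) (le : rel 'X_{1..n}) : Prop :=
  [/\ total le, antisymmetric le, transitive le,
      forall m, le 0%MM m
    & forall m1 m2 m, le m1 m2 -> le (m1 + m)%MM (m2 + m)%MM].

(* No monomial is the initial monomial of the zero polynomial. *)
Definition initial_monomial (K : fieldType) (n : nat) (le : rel 'X_{1..n})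
    (f : {mpoly K[n]}) (m : 'X_{1..n}) : Prop :=
  m \in msupp f /\ forall m', m' \in msupp f -> le m' m.

Definition initial_ideal (K : fieldType) (n : nat) (le : rel 'X_{1..n})
    (E : {mpoly K[n]} -> Prop) : {mpoly K[n]} -> Prop :=
  ideal_gen (fun q => exists f m,
    [/\ E f, initial_monomial le f m & q = f@_m *: 'X_[m]]).

Definition groebner_basis (K : fieldType) (n : nat) (le : rel 'X_{1..n})
    (G J : {mpoly K[n]} -> Prop) : Prop :=
  [/\ exists s : seq {mpoly K[n]}, forall g, G g <-> g \in s,
      forall g, G g -> J g
    & forall q, initial_ideal le J q <-> initial_ideal le G q].

Definition generated_by_monomials (K : fieldType) (n : nat)
    (M : 'X_{1..n} -> Prop) (I : {mpoly K[n]} -> Prop) : Prop :=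
  forall p, I p <-> ideal_gen (fun q => exists2 m, M m & q = 'X_[m]) p.

(* The variables are numbered from 0; 'X_0 plays the role of x_1. *)
Definition strongly_stable (K : fieldType) (n : nat)
    (I : {mpoly K[n]} -> Prop) : Prop :=
  (exists M, generated_by_monomials M I) /\
  (forall (m : 'X_{1..n}) (i j : 'I_n),
     I 'X_[m] -> (0 < m i)%N -> (j < i)%N -> I 'X_[m - U_(i) + U_(j)]).

Definition minimal_monomial_generators (K : fieldType) (n : nat)
    (M : 'X_{1..n} -> Prop) (I : {mpoly K[n]} -> Prop) : Prop :=
  generated_by_monomials M I /\
  forall M' : 'X_{1..n} -> Prop,
    (forall m, M' m -> M m) -> generated_by_monomials M' I ->
    forall m, M m -> M' m.

(* Graded reverse lexicographic order with x_1 > ... > x_n.  The order on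
   'X_{1..n} provided by mpoly.v breaks ties lexicographically instead. *)
Definition rlex_gt (n : nat) (m1 m2 : 'X_{1..n}) : Prop :=
  (mdeg m2 < mdeg m1)%N \/
  mdeg m1 = mdeg m2 /\
  exists i : 'I_n,
    (m1 i < m2 i)%N /\ forall j : 'I_n, (i < j)%N -> m1 j = m2 j.

Definition lists_minimal_generators (K : fieldType) (n s : nat)
    (u : 'I_s -> 'X_{1..n}) (I : {mpoly K[n]} -> Prop) : Prop :=
  minimal_monomial_generators (fun m => exists j, m = u j) I /\
  forall j k : 'I_s, (j < k)%N -> rlex_gt (u j) (u k).

(* Polynomial rings in two blocks of variables: in 'X_{1..a + b} the indices
    [lshift b i] form the first block and the indices [rshift a j] the second *)

Definition mnm_fst (a b : nat) (m : 'X_{1..a}) : 'X_{1..a + b} :=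
  [multinom (if split v is inl i then m i else 0%N) | v < a + b].

Definition mnm_snd (a b : nat) (m : 'X_{1..b}) : 'X_{1..a + b} :=
  [multinom (if split v is inr j then m j else 0%N) | v < a + b].

(* R' = K[T_(i,j)] is {mpoly K[\sum_(i < r) s i]}, the variable T_(i,j) having
    index [tagnat.Rank i j]; R = S[T_(i,j)] is the polynomial ring over K in the
    block x followed by the block T; S[t_1, ..., t_r] is the polynomial ring
    over K in the block x followed by the block t.  The defining ideal of the
    multi-Rees algebra is the kernel of [rees_map]. *)

Section MultiRees.

Variables (K : fieldType) (n r : nat) (s : 'I_r -> nat).
Variable u : forall i : 'I_r, 'I_(s i) -> 'X_{1..n}.
Local Notation N := (\sum_(i < r) s i)%N.

Definition x_index (i : 'I_n) : 'I_(n + N) := lshift N i.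
Definition T_index (l : 'I_r) (k : 'I_(s l)) : 'I_(n + N) :=
  rshift n (tagnat.Rank l k).

(* u_(i,j) t_i, where q is the index of T_(i,j) *)
Definition gen_t (q : 'I_N) : {mpoly K[n + r]} :=
  'X_[mnm_fst r (u (tagnat.sig2 q))] * 'X_(rshift n (tagnat.sig1 q)).

Definition rees_map (p : {mpoly K[n + N]}) : {mpoly K[n + r]} :=
  p \mPo [tuple match split v with
                | inl i => 'X_(lshift r i)
                | inr q => gen_t q
                end | v < n + N].

Definition rees_ideal (p : {mpoly K[n + N]}) : Prop := rees_map p = 0.

Definition fiber_map (p : {mpoly K[N]}) : {mpoly K[n + r]} :=
  p \mPo [tuple gen_t q | q < N].

Definition toric_ideal (p : {mpoly K[N]}) : Prop := fiber_map p = 0.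

Definition T_inclusion (p : {mpoly K[N]}) : {mpoly K[n + N]} :=
  p \mPo [tuple 'X_(rshift n q) | q < N].

Definition extends_order (tau : rel 'X_{1..n + N}) (tau' : rel 'X_{1..N}) :
    Prop :=
  forall m1 m2, tau (mnm_snd n m1) (mnm_snd n m2) = tau' m1 m2.

Definition linear_syzygy (i j : 'I_n) (l : 'I_r) (k k' : 'I_(s l)) : Prop :=
  (i < j)%N /\ (U_(i) + u k)%MM = (U_(j) + u k')%MM.

Definition linear_relation (i j : 'I_n) (l : 'I_r) (k k' : 'I_(s l)) :
    {mpoly K[n + N]} :=
  'X_(x_index i) * 'X_(T_index k) - 'X_(x_index j) * 'X_(T_index k').

Definition rees_basis (G' : {mpoly K[N]} -> Prop) (g : {mpoly K[n + N]}) :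
    Prop :=
  (exists i j l (k k' : 'I_(s l)),
     linear_syzygy i j k k' /\ g = linear_relation i j k k') \/
  (exists2 g', G' g' & g = T_inclusion g').

End MultiRees.

(* Main.v *)
(* Let tau compare the x-parts first, by the graded lexicographic order, and
   break ties on the T-parts with tau'.  The leading monomial m = x^a T^alpha of
   an element of the kernel of a monomial map shares its image with a smaller
   monomial m' = x^b T^beta of the support.  If a = b, then T^alpha - T^beta lies
   in the toric ideal, so an initial monomial of G' divides T^alpha.  Otherwise
   |a| = |b|, because the generators of each I_l have one degree; at the first
   index i where they differ a_i > b_i, hence a_j < b_j for some j > i, so x_j
   divides some u_(l,k) with T_(l,k) dividing T^alpha.  Strong stability makes
   x_i u_(l,k) / x_j a minimal generator, and x_i T_(l,k), which divides m, is
   the initial monomial of a linear relation. *)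
Require Import Defs.
From mathcomp Require Import all_boot all_order all_algebra.

Set Implicit Arguments.
Unset Strict Implicit.
Unset Printing Implicit Defensive.

Import Order.TTheory GRing.Theory.

Local Open Scope ring_scope.

(** * Ideals generated by a set *)

Section IdealGen.

Variable A : comNzRingType.
Implicit Types (E F : A -> Prop) (p q : A).

Lemma ideal_gen0 E : ideal_gen E 0.
Proof. by exists [::]; rewrite big_nil. Qed.

Lemma ideal_gen_mem E p : E p -> ideal_gen E p.
Proof.
move=> Ep; exists [:: (1, p)]; rewrite big_seq1 mul1r; split=> // c.
by rewrite inE => /eqP->.
Qed.

Lemma ideal_genD E p q : ideal_gen E p -> ideal_gen E q -> ideal_gen E (p + q).
Proof.
move=> [s1 [Es1 ->]] [s2 [Es2 ->]]; exists (s1 ++ s2); rewrite big_cat.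
by split=> // c; rewrite mem_cat => /orP[/Es1|/Es2].
Qed.

Lemma ideal_genM E p q : ideal_gen E q -> ideal_gen E (p * q).
Proof.
move=> [s [Es ->]]; exists [seq (p * c.1, c.2) | c <- s]; split=> [c|].
  by move=> /mapP[c' /Es ? ->].
by rewrite big_map mulr_sumr; apply: eq_bigr => c _; rewrite mulrA.
Qed.

Lemma ideal_gen_sub E F p :
  (forall q, E q -> ideal_gen F q) -> ideal_gen E p -> ideal_gen F p.
Proof.
move=> sEF [s [Es ->]]; elim: s Es => [|c s IHs] Es.
  by rewrite big_nil; apply: ideal_gen0.
rewrite big_cons; apply: ideal_genD.
  by apply: ideal_genM; apply/sEF/Es; rewrite mem_head.
by apply: IHs => c' c's; apply: Es; rewrite inE c's orbT.
Qed.

End IdealGen.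

(** * Ideals generated by terms, and initial ideals *)

Section MonomialIdeals.

Variables (K : fieldType) (n : nat).
Implicit Types (p f : {mpoly K[n]}) (m : 'X_{1..n}).

Lemma mcoeffMX_neq0 p m k : (p * 'X_[m])@_k != 0 -> (m <= k)%MM.
Proof.
rewrite {1}(mpolyE p) mulr_suml raddf_sum /= => nz.
apply: contraNT nz => nlek; apply/eqP; apply: big1 => l _.
rewrite -scalerAl -mpolyXD mcoeffZ mcoeffX.
case: eqP => [e|_]; last by rewrite mulr0.
by case/negP: nlek; rewrite -e lem_addl.
Qed.

(** The coefficient of ['X_[k]] in the combination is 1, so at least one summand contributes to it.
    That summand is a multiple of some ['X_[m]] with [M m], hence [m] divides [k]. *)
Lemma ideal_gen_terms (E : {mpoly K[n]} -> Prop) (M : 'X_{1..n} -> Prop) k :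
    (forall q, E q -> exists c m, M m /\ q = c *: 'X_[m]) ->
  ideal_gen E 'X_[k] -> exists2 m, M m & (m <= k)%MM.
Proof.
move=> EM [s [Es Xk]].
have : 'X_[k]@_k != 0 :> K by rewrite mcoeffX eqxx oner_neq0.
rewrite Xk raddf_sum /=.
elim: s Es {Xk} => [|c s IHs] Es; first by rewrite big_nil eqxx.
rewrite big_cons; have [c0|cn0 _] := eqVneq ((c.1 * c.2)@_k) 0.
  rewrite c0 add0r; apply: IHs => c' c's.
  by apply: Es; rewrite inE c's orbT.
have [|a [m [Mm c2E]]] := EM c.2; first by apply: Es; rewrite mem_head.
exists m => //; apply: (mcoeffMX_neq0 (p := a *: c.1)).
by rewrite -scalerAl scalerAr -c2E.
Qed.

Lemma generated_by_monomialsP (M : 'X_{1..n} -> Prop) I m :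
  generated_by_monomials (K := K) M I -> I 'X_[m] ->
  exists2 m', M m' & (m' <= m)%MM.
Proof.
move=> genI /genI; apply: ideal_gen_terms => q [m' Mm' ->].
by exists 1, m'; rewrite scale1r.
Qed.

Variable le : rel 'X_{1..n}.

Lemma initial_ideal_mono (E F : {mpoly K[n]} -> Prop) q :
  (forall f, E f -> F f) -> initial_ideal le E q -> initial_ideal le F q.
Proof.
move=> sEF; apply: ideal_gen_sub => _ [f [m [Ef fm ->]]].
by apply: ideal_gen_mem; exists f, m; split=> //; apply: sEF.
Qed.

(** Reduces an inclusion of initial ideals to divisibility of initial monomials. Over a field the
    leading coefficients can be adjusted by a scalar. *)
Lemma initial_ideal_sub (E F : {mpoly K[n]} -> Prop) q :
    (forall f m, E f -> initial_monomial le f m ->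
       exists g k, [/\ F g, initial_monomial le g k & (k <= m)%MM]) ->
  initial_ideal le E q -> initial_ideal le F q.
Proof.
move=> EF; apply: ideal_gen_sub => _ [f [m [Ef fm ->]]].
have [g [k [Fg gk lekm]]] := EF f m Ef fm.
have gk0 : g@_k != 0 by rewrite -mcoeff_msupp; case: gk.
have -> : f@_m *: 'X_[m] =
    ((f@_m / g@_k) *: 'X_[m - k]) * (g@_k *: 'X_[k]) :> {mpoly K[n]}.
  by rewrite -scalerAl -scalerAr scalerA divfK // -mpolyXD submK.
by apply: ideal_genM; apply: ideal_gen_mem; exists g, k.
Qed.

Lemma initial_ideal_mem (E : {mpoly K[n]} -> Prop) f m :
  E f -> initial_monomial le f m -> initial_ideal le E 'X_[m].
Proof.
move=> Ef fm; have fm0 : f@_m != 0 by rewrite -mcoeff_msupp; case: fm.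
have -> : 'X_[m] = (f@_m)^-1%:MP * (f@_m *: 'X_[m]) :> {mpoly K[n]}.
  by rewrite mul_mpolyC scalerA mulVf // scale1r.
by apply: ideal_genM; apply: ideal_gen_mem; exists f, m.
Qed.

Lemma initial_ideal_dvd (E : {mpoly K[n]} -> Prop) m :
  initial_ideal le E 'X_[m] ->
  exists g k, [/\ E g, initial_monomial le g k & (k <= m)%MM].
Proof.
move=> Em.
have [k [g []]] : exists2 k, (exists g, E g /\ initial_monomial le g k)
    & (k <= m)%MM.
  apply: ideal_gen_terms Em => q [g [k [Eg gk ->]]].
  by exists (g@_k), k; split=> //; exists g.
by exists g, k; split.
Qed.

Lemma initial_monomial_binomial m1 m2 :
  total le -> m1 != m2 -> le m2 m1 ->
  initial_monomial le ('X_[m1] - 'X_[m2] : {mpoly K[n]}) m1.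
Proof.
move=> le_total ne12 le21; split=> [|m].
  rewrite mcoeff_msupp mcoeffB !mcoeffX eqxx [m2 == _]eq_sym (negPf ne12).
  by rewrite subr0 oner_neq0.
rewrite mcoeff_msupp mcoeffB !mcoeffX.
(* Reflexivity of [le] is read off from totality. *)
have [<- _|_] := eqVneq m1 m; first by case/orP: (le_total m1 m1).
by have [<-//|_] := eqVneq m2 m; rewrite subr0 eqxx.
Qed.

End MonomialIdeals.

(** * Monomial maps, acting on exponents through [mnm_subst] *)

Definition mnm_subst (a b : nat) (e : 'I_a -> 'X_{1..b}) (m : 'X_{1..a}) :
    'X_{1..b} :=
  (\sum_i e i *+ m i)%MM.

Section MonomialMaps.

Variables (K : fieldType) (a b : nat) (e : 'I_a -> 'X_{1..b}).
Variable lq : a.-tuple {mpoly K[b]}.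
Hypothesis lqE : forall i, tnth lq i = 'X_[e i].
Implicit Types (p : {mpoly K[a]}) (m : 'X_{1..a}).

Lemma mnm_substE m i : mnm_subst e m i = (\sum_j e j i * m j)%N.
Proof. by rewrite mnm_sumE; apply: eq_bigr => j _; rewrite mulmnE. Qed.

Lemma comp_mpoly_mnm m : 'X_[m] \mPo lq = 'X_[mnm_subst e m].
Proof.
rewrite comp_mpolyX [RHS](big_morph _ (@mpolyXD _ _) (mpolyX0 _ _)).
apply: eq_bigr => i _.
by rewrite lqE mpolyXn.
Qed.

Lemma mcoeff_comp_mpoly_mnm p k :
  (p \mPo lq)@_k = \sum_(m <- msupp p | mnm_subst e m == k) p@_m.
Proof.
rewrite comp_mpolyEX raddf_sum [RHS]big_mkcond /=.
apply: eq_bigr => m _; rewrite comp_mpoly_mnm mcoeffZ mcoeffX.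
by case: eqP; rewrite ?mulr1 ?mulr0.
Qed.

(** The coefficient of the image of [p] at the image of [m] is the sum of the coefficients of [p]
    over the fibre through [m]. This sum vanishes while [p@_m] does not, so another monomial of the
    support lies in the fibre. *)
Lemma comp_mpoly_mnm_eq0 p m : p \mPo lq = 0 -> m \in msupp p ->
  exists m', [/\ m' \in msupp p, m' != m & mnm_subst e m' = mnm_subst e m].
Proof.
move=> p0 pm; have /esym := mcoeff_comp_mpoly_mnm p (mnm_subst e m).
rewrite p0 mcoeff0 big_mkcond (bigD1_seq m) //= eqxx => s0.
(* Without such an [m'] the vanishing sum would reduce to [p@_m]. *)
have /hasP[m' pm' /andP[/eqP ? ?]] :
    has (fun m' => (mnm_subst e m' == mnm_subst e m) && (m' != m)) (msupp p).
  apply: contraLR pm; rewrite -all_predC => /allP none.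
  rewrite mcoeff_msupp negbK.
  move: s0; rewrite big1_seq ?addr0 => [->//|m' /andP[ne /none]] /=.
  by rewrite ne andbT => /negPf->.
by exists m'; split.
Qed.

Lemma mcoeff_comp_mpoly_inj p m :
  injective (mnm_subst e) -> (p \mPo lq)@_(mnm_subst e m) = p@_m.
Proof.
move=> e_inj; rewrite mcoeff_comp_mpoly_mnm.
under eq_bigl do rewrite (inj_eq e_inj).
have [pm|npm] := boolP (m \in msupp p).
  rewrite big_mkcond (bigD1_seq m) //= eqxx big1 ?addr0 // => m'.
  by move=> /negPf->.
rewrite memN_msupp_eq0 // big_seq_cond big1 // => m' /andP[pm' /eqP mm'].
by rewrite -mm' pm' in npm.
Qed.

Lemma msupp_comp_mpoly_mnm p k : k \in msupp (p \mPo lq) ->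
  exists2 m, m \in msupp p & k = mnm_subst e m.
Proof.
rewrite mcoeff_msupp mcoeff_comp_mpoly_mnm => nz.
have /hasP[m pm /eqP <-] : has (fun m => mnm_subst e m == k) (msupp p).
  apply: contraNT nz; rewrite -all_predC => /allP none.
  by rewrite big_seq_cond big1 // => m /andP[/none/negP].
by exists m.
Qed.

End MonomialMaps.

(** * Monomials in two blocks of variables, and the product order *)

Section Blocks.

Variables a b : nat.
Implicit Types m : 'X_{1..a + b}.

Definition block_fst m : 'X_{1..a} := [multinom m (lshift b i) | i < a].
Definition block_snd m : 'X_{1..b} := [multinom m (rshift a j) | j < b].

Lemma block_eqP m1 m2 :
  block_fst m1 = block_fst m2 -> block_snd m1 = block_snd m2 -> m1 = m2.
Proof.
move=> /mnmP e1 /mnmP e2; apply/mnmP => v.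
case: (splitP v) => [i vi|j vj].
  have -> : v = lshift b i by apply: val_inj.
  by have := e1 i; rewrite !mnmE.
have -> : v = rshift a j by apply: val_inj.
by have := e2 j; rewrite !mnmE.
Qed.

Lemma block_fstD m1 m2 : block_fst (m1 + m2) = (block_fst m1 + block_fst m2)%MM.
Proof. by apply/mnmP => i; rewrite !mnmE. Qed.

Lemma block_sndD m1 m2 : block_snd (m1 + m2) = (block_snd m1 + block_snd m2)%MM.
Proof. by apply/mnmP => i; rewrite !mnmE. Qed.

Lemma block_fst0 : block_fst 0 = 0%MM.
Proof. by apply/mnmP => i; rewrite !mnmE. Qed.

Lemma block_snd0 : block_snd 0 = 0%MM.
Proof. by apply/mnmP => i; rewrite !mnmE. Qed.

Lemma block_fst_snd (m : 'X_{1..b}) : block_fst (mnm_snd a m) = 0%MM.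
Proof. by apply/mnmP => i; rewrite !mnmE (unsplitK (inl i)). Qed.

Lemma block_snd_snd (m : 'X_{1..b}) : block_snd (mnm_snd a m) = m.
Proof. by apply/mnmP => i; rewrite !mnmE (unsplitK (inr i)). Qed.

Lemma mnm_snd_block_snd m : (mnm_snd a (block_snd m) <= m)%MM.
Proof.
apply/mnm_lepP => v; rewrite !mnmE; case: splitP => [//|j vj].
by rewrite mnmE (_ : rshift a j = v) //; apply: val_inj.
Qed.

Lemma mnm_snd_le (m1 m2 : 'X_{1..b}) :
  (m1 <= m2)%MM -> (mnm_snd a m1 <= mnm_snd a m2)%MM.
Proof.
move=> /mnm_lepP le12; apply/mnm_lepP => v; rewrite !mnmE.
by case: (split v).
Qed.

(** The strict order on the first block compares degrees first and then breaks ties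
    lexicographically, the variable of smallest index being the largest. *)
Definition block_order (le : rel 'X_{1..b}) : rel 'X_{1..a + b} :=
  fun m1 m2 => (block_fst m1 < block_fst m2)%O ||
    (block_fst m1 == block_fst m2) && le (block_snd m1) (block_snd m2).

Lemma block_order_monomial le :
  monomial_order le -> monomial_order (block_order le).
Proof.
move=> [le_total le_anti le_trans le0 leD]; split.
- move=> m1 m2; rewrite /block_order.
  by case: ltgtP => //= _; apply: le_total.
- move=> m1 m2; rewrite /block_order.
  by case: ltgtP => //= e /le_anti; apply: block_eqP.
- move=> m2 m1 m3; rewrite /block_order.
  case/orP=> [lt12|/andP[/eqP-> le12]].
    by case/orP=> [lt23|/andP[/eqP<- _]]; rewrite ?(lt_trans lt12 lt23) ?lt12.
  case/orP=> [->//|/andP[-> le23]].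
  by rewrite (le_trans _ _ _ le12 le23) orbT.
- move=> m; rewrite /block_order block_fst0 block_snd0 le0 andbT.
  by rewrite orbC -le_eqVlt le0x.
- move=> m1 m2 m; rewrite /block_order !block_fstD !block_sndD.
  rewrite ltmc_add2l eqm_add2r; case/orP=> [->//|/andP[-> /leD->]].
  by rewrite orbT.
Qed.

Lemma block_order_snd le (m1 m2 : 'X_{1..b}) :
  block_order le (mnm_snd a m1) (mnm_snd a m2) = le m1 m2.
Proof. by rewrite /block_order !block_fst_snd !block_snd_snd ltxx eqxx. Qed.

End Blocks.

Lemma mnm_fst_lshift a b (m : 'X_{1..a}) i : mnm_fst b m (lshift b i) = m i.
Proof. by rewrite mnmE (unsplitK (inl i)). Qed.

Lemma mnm_fst_rshift a b (m : 'X_{1..a}) j : mnm_fst b m (rshift a j) = 0%N.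
Proof. by rewrite mnmE (unsplitK (inr j)). Qed.

Lemma mnm_fstD a b (m1 m2 : 'X_{1..a}) :
  mnm_fst b (m1 + m2) = (mnm_fst b m1 + mnm_fst b m2)%MM.
Proof. by apply/mnmP => v; rewrite !mnmE; case: split => // i; rewrite mnmE. Qed.

Lemma mnm_substU a b (e : 'I_a -> 'X_{1..b}) i : mnm_subst e U_(i) = e i.
Proof.
apply/mnmP => v; rewrite mnm_substE (bigD1 i) //= big1 => [|j ne].
  by rewrite mnm1E eqxx muln1 addn0.
by rewrite mnm1E eq_sym (negPf ne) muln0.
Qed.

Lemma mnm_subst_lshift a b (m : 'X_{1..a}) :
  mnm_subst (fun i => U_(lshift b i)%MM) m = mnm_fst b m.
Proof.
apply/mnmP => v; rewrite mnm_substE -(splitK v); case: split => i /=.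
  rewrite mnm_fst_lshift (bigD1 i) //= mnm1E eqxx mul1n big1 ?addn0 // => j ne.
  by rewrite mnm1E eq_lshift (negPf ne).
by rewrite mnm_fst_rshift big1 // => j _; rewrite mnm1E eq_lrshift.
Qed.

Lemma mnm_subst_rshift a b (m : 'X_{1..b}) :
  mnm_subst (fun i => U_(rshift a i)%MM) m = mnm_snd a m.
Proof.
apply/mnmP => v; rewrite mnm_substE mnmE -{1}(splitK v); case: split => i /=.
  by rewrite big1 // => j _; rewrite mnm1E eq_rlshift.
rewrite (bigD1 i) //= mnm1E eqxx mul1n big1 ?addn0 // => j ne.
by rewrite mnm1E eq_rshift (negPf ne).
Qed.

(** This decides which term of a linear relation is initial: its two terms already differ in their
    x-parts. *)
Lemma ltmc_U n (i j : 'I_n) : (i < j)%N -> (U_(j)%MM < U_(i)%MM :> 'X_{1..n})%O.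
Proof.
move=> ltij; apply/ltmcP; first by rewrite !mdeg1.
exists i => [k ltki|]; last by rewrite !mnm1E eqxx -val_eqE (gtn_eqF ltij).
by rewrite !mnm1E -!val_eqE (gtn_eqF ltki) (gtn_eqF (ltn_trans ltki ltij)).
Qed.

(** * The Rees and fiber maps on exponents *)

Section MultiReesExponents.

Variables (K : fieldType) (n r : nat) (s : 'I_r -> nat).
Variable u : forall i : 'I_r, 'I_(s i) -> 'X_{1..n}.
Local Notation N := (\sum_(i < r) s i)%N.

Definition fiber_mnm (q : 'I_N) : 'X_{1..n + r} :=
  (mnm_fst r (u (tagnat.sig2 q)) + U_(rshift n (tagnat.sig1 q)))%MM.

Definition rees_mnm (v : 'I_(n + N)) : 'X_{1..n + r} :=
  match split v with inl i => U_(lshift r i)%MM | inr q => fiber_mnm q end.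

Lemma fiber_mnm_Rank l (k : 'I_(s l)) :
  fiber_mnm (tagnat.Rank l k) = (mnm_fst r (u k) + U_(rshift n l))%MM.
Proof.
by rewrite /fiber_mnm /tagnat.sig2 /tagnat.sig1 /tagnat.Rank tagnat.rankK.
Qed.

Lemma fiber_map_tupleE q : tnth [tuple gen_t K u q | q < N] q = 'X_[fiber_mnm q].
Proof. by rewrite tnth_mktuple mpolyXD. Qed.

Lemma rees_map_tupleE v :
  tnth [tuple match split v with
              | inl i => 'X_(lshift r i)
              | inr q => gen_t K u q
              end | v < n + N] v = 'X_[rees_mnm v].
Proof.
by rewrite tnth_mktuple /rees_mnm; case: split => // q; rewrite mpolyXD.
Qed.

Lemma rees_mnmE m : mnm_subst rees_mnm m =
  (mnm_fst r (block_fst m) + mnm_subst fiber_mnm (block_snd m))%MM.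
Proof.
rewrite /mnm_subst big_split_ord -mnm_subst_lshift; congr (_ + _)%MM.
  by apply: eq_bigr => i _; rewrite /rees_mnm (unsplitK (inl i)) mnmE.
by apply: eq_bigr => i _; rewrite /rees_mnm (unsplitK (inr i)) mnmE.
Qed.

Lemma rees_mnm_snd m :
  mnm_subst rees_mnm (mnm_snd n m) = mnm_subst fiber_mnm m.
Proof.
rewrite rees_mnmE block_fst_snd block_snd_snd.
rewrite (_ : mnm_fst r 0%MM = 0%MM) ?add0m //.
by apply/mnmP => v; rewrite !mnmE; case: split => // i; rewrite mnmE.
Qed.

Lemma block_fst_xT i q : block_fst (U_(lshift N i) + U_(rshift n q))%MM =
  U_(i)%MM.
Proof.
by apply/mnmP => v; rewrite mnmE mnmDE !mnm1E eq_lshift eq_rlshift addn0.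
Qed.

Lemma block_snd_xT i q : block_snd (U_(lshift N i) + U_(rshift n q))%MM =
  U_(q)%MM.
Proof. by apply/mnmP => v; rewrite mnmE mnmDE !mnm1E eq_lrshift eq_rshift. Qed.

Lemma linear_relationE i j l (k k' : 'I_(s l)) :
  linear_relation K i j k k' =
  'X_[U_(x_index s i) + U_(T_index n k)] -
  'X_[U_(x_index s j) + U_(T_index n k')].
Proof. by rewrite !mpolyXD. Qed.

(** Both terms are sent to the same monomial, since [T_(l,k)] and [T_(l,k')] carry the same factor
    [t_l]. *)
Lemma linear_relation_rees i j l (k k' : 'I_(s l)) :
  linear_syzygy u i j k k' -> rees_ideal u (linear_relation K i j k k').
Proof.
move=> [_ e]; rewrite linear_relationE /rees_ideal /rees_map comp_mpolyB.
rewrite !(comp_mpoly_mnm rees_map_tupleE) !rees_mnmE !block_fst_xT !block_snd_xT.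
by rewrite !mnm_substU !fiber_mnm_Rank !addmA -!mnm_fstD e subrr.
Qed.

Lemma T_inclusion_tupleE q :
  tnth [tuple 'X_(rshift n q) | q < N] q = 'X_[U_(rshift n q)] :> {mpoly K[n + N]}.
Proof. by rewrite tnth_mktuple. Qed.

Lemma rees_map_T_inclusion (g : {mpoly K[N]}) :
  rees_map u (T_inclusion n g) = fiber_map u g.
Proof.
rewrite /T_inclusion comp_mpolyEX /fiber_map [RHS]comp_mpolyEX.
rewrite /rees_map linear_sum; apply: eq_bigr => m _ /=.
rewrite comp_mpolyZ !(comp_mpoly_mnm T_inclusion_tupleE) mnm_subst_rshift.
by rewrite (comp_mpoly_mnm rees_map_tupleE) rees_mnm_snd
  (comp_mpoly_mnm fiber_map_tupleE).
Qed.

(** The inclusion is injective on monomials, so no terms cancel, and [block_order] restricts to [le]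
    on monomials without x-part. *)
Lemma T_inclusion_initial (le : rel 'X_{1..N}) (g : {mpoly K[N]}) m :
  initial_monomial le g m ->
  initial_monomial (@block_order n N le) (T_inclusion n g) (mnm_snd n m).
Proof.
have inj : injective (mnm_subst (fun q : 'I_N => U_(rshift n q)%MM)).
  move=> m1 m2; rewrite !mnm_subst_rshift => /(congr1 (@block_snd n N)).
  by rewrite !block_snd_snd.
move=> [gm m_max]; split=> [|m'].
  rewrite mcoeff_msupp -mnm_subst_rshift.
  by rewrite (mcoeff_comp_mpoly_inj T_inclusion_tupleE) // -mcoeff_msupp.
move=> /(msupp_comp_mpoly_mnm T_inclusion_tupleE)[m1 gm1 ->].
by rewrite mnm_subst_rshift block_order_snd m_max.
Qed.

(** * Degree count for generators of constant degree *)

Variable d : 'I_r -> nat.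
Hypothesis u_deg : forall i (j : 'I_(s i)), mdeg (u j) = d i.

(** Each factor [T_(l,k)] contributes [d l] to the x-degree of the image and 1 to the exponent of
    [t_l]; both sides therefore count the factors of [m] with weight [d l]. *)
Lemma fiber_mnm_degree (m : 'X_{1..N}) :
  (\sum_i mnm_subst fiber_mnm m (lshift r i) =
   \sum_l d l * mnm_subst fiber_mnm m (rshift n l))%N.
Proof.
transitivity (\sum_q d (tagnat.sig1 q) * m q)%N.
  under eq_bigr do rewrite mnm_substE.
  rewrite exchange_big /=; apply: eq_bigr => q _.
  rewrite -big_distrl /= -(u_deg (tagnat.sig2 q)) mdegE; congr (_ * _)%N.
  apply: eq_bigr => i _.
  by rewrite mnmDE mnm_fst_lshift mnm1E eq_rlshift addn0.
under [RHS]eq_bigr do rewrite mnm_substE big_distrr.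
rewrite exchange_big /=; apply: eq_bigr => q _.
have E l : fiber_mnm q (rshift n l) = (tagnat.sig1 q == l) :> nat.
  by rewrite mnmDE mnm_fst_rshift mnm1E eq_rshift.
rewrite [RHS](bigD1 (tagnat.sig1 q)) //= E eqxx mul1n.
rewrite [X in (_ + X)%N]big1 ?addn0 // => l ne.
by rewrite E eq_sym (negPf ne) muln0.
Qed.

(** The degree of the x-part can be recovered from the image: it is the x-degree of the image minus
    the t-exponents weighted by [d]. *)
Lemma rees_mnm_fst_degree (m1 m2 : 'X_{1..n + N}) :
  mnm_subst rees_mnm m1 = mnm_subst rees_mnm m2 ->
  mdeg (block_fst m1) = mdeg (block_fst m2).
Proof.
move=> e12; set f := mnm_subst fiber_mnm.
have sndE m l : mnm_subst rees_mnm m (rshift n l) = f (block_snd m) (rshift n l).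
  by rewrite rees_mnmE mnmDE mnm_fst_rshift.
have fstE m : (\sum_i mnm_subst rees_mnm m (lshift r i) = mdeg (block_fst m) +
    \sum_l d l * mnm_subst rees_mnm m (rshift n l))%N.
  have -> : (\sum_l d l * mnm_subst rees_mnm m (rshift n l) =
      \sum_l d l * f (block_snd m) (rshift n l))%N.
    by apply: eq_bigr => l _; rewrite sndE.
  rewrite -fiber_mnm_degree mdegE -big_split /=; apply: eq_bigr => i _.
  by rewrite rees_mnmE mnmDE mnm_fst_lshift.
apply/eqP.
rewrite -(eqn_add2r (\sum_l d l * mnm_subst rees_mnm m1 (rshift n l))).
by rewrite {2}e12 -!fstE e12.
Qed.

(** * Linear relations from strong stability *)

Variable I : 'I_r -> {mpoly K[n]} -> Prop.
Hypothesis I_stable : forall i, strongly_stable (I i).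
Hypothesis u_gens : forall i, lists_minimal_generators (@u i) (I i).

(** Strong stability puts [x_i u_k / x_j] in [I l], so some generator [u k'] divides it. Both have
    degree [d l], which forces equality. *)
Lemma linear_syzygy_exists (i j : 'I_n) l (k : 'I_(s l)) :
  (i < j)%N -> (0 < u k j)%N -> exists k' : 'I_(s l), linear_syzygy u i j k k'.
Proof.
move=> ltij ukj; have [[genI _] _] := u_gens l.
have Iuk : I l 'X_[u k].
  apply/genI; apply: ideal_gen_mem; exists (u k) => //; by exists k.
have [_ /(_ _ j i Iuk ukj ltij)] := I_stable l.
move=> /(generated_by_monomialsP genI)[_ [k' ->] le_k'].
have Uuk : (U_(j) <= u k)%MM by rewrite lep1mP -lt0n.
have E : (u k - U_(j) + U_(i) = u k')%MM.
  (* The cofactor [t] has degree 0, hence is trivial. *)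
  have := submK le_k'; set t := (_ - u k')%MM => tE.
  suff: mdeg t == 0%N by rewrite mdeg_eq0 => /eqP t0; rewrite -tE t0 add0m.
  have := congr1 mdeg tE; rewrite !mdegD !mdeg1 u_deg => dE.
  have := congr1 mdeg (submK Uuk); rewrite mdegD mdeg1 u_deg => dE'.
  by rewrite -(eqn_add2r (d l)) dE dE'.
by exists k'; split=> //; rewrite -E addmA [(U_(j) + _)%MM]addmC submK // addmC.
Qed.

Lemma linear_relation_dvd (m m' : 'X_{1..n + N}) :
    mnm_subst rees_mnm m' = mnm_subst rees_mnm m ->
    (block_fst m' < block_fst m)%O ->
  exists i j l (k k' : 'I_(s l)),
    linear_syzygy u i j k k' /\ (U_(x_index s i) + U_(T_index n k) <= m)%MM.
Proof.
move=> mm' lt_m'm; have deg_mm' := rees_mnm_fst_degree mm'.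
have [i eq_lt lti] := ltmcP deg_mm' lt_m'm.
(* The x-parts have equal degree, so the excess of [m] at [i] must be compensated at some [j]. *)
have [j ltj] : exists j, (block_fst m j < block_fst m' j)%N.
  apply/existsP; apply: contraTT isT; rewrite negb_exists => /forallP none.
  have : (mdeg (block_fst m') < mdeg (block_fst m))%N.
    rewrite !mdegE (bigD1 i) // [ltnRHS](bigD1 i) //= -addSn leq_add //.
    by apply: leq_sum => j _; rewrite leqNgt.
  by rewrite deg_mm' ltnn.
(* [i] is the first index of difference, and there [m] is the larger. *)
have ltij : (i < j)%N.
  rewrite ltnNge leq_eqVlt; apply/negP => /orP[/eqP/val_inj ji|/eq_lt ji].
    by move: ltj; rewrite ji ltnNge ltnW.
  by move: ltj; rewrite ji ltnn.
(* The images agree at [x_j] although the x-part of [m] has the smaller exponent there, so the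
   T-part of [m] has to supply a factor [x_j]. *)
have : mnm_subst fiber_mnm (block_snd m) (lshift r j) != 0%N.
  have /(congr1 (fun x : 'X_{1..n + r} => x (lshift r j))) := mm'.
  rewrite !rees_mnmE !mnmDE !mnm_fst_lshift => e.
  rewrite -lt0n -(ltn_add2l (block_fst m j)) addn0 -e.
  exact: leq_trans ltj (leq_addr _ _).
rewrite mnm_substE sum_nat_eq0 negb_forall => /existsP[q].
rewrite mnmDE mnm_fst_lshift mnm1E eq_rlshift addn0 muln_eq0 negb_or -!lt0n.
move=> /andP[uqj mq].
have [k' syz] := linear_syzygy_exists ltij uqj.
exists i, j, _, (tagnat.sig2 q), k'; split=> //.
rewrite /T_index tagnat.sig2K; apply/mnm_lepP => v; rewrite mnmDE !mnm1E.
(* [x_i] divides [m] because its exponent exceeds that in [m'], and [T_q] divides [m] by the choice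
   of [q]; the two variables lie in different blocks. *)
move: lti mq; rewrite !mnmE -(splitK v); case: split => w /=.
  rewrite eq_lshift eq_rlshift addn0; case: eqP => [<-|//] lti _.
  exact: leq_ltn_trans lti.
by rewrite eq_lrshift eq_rshift; case: eqP => [<-|].
Qed.

(** * The Gröbner basis of the Rees ideal *)

Variables (tau' : rel 'X_{1..N}) (G' : {mpoly K[N]} -> Prop).
Hypothesis tau'_order : monomial_order tau'.
Hypothesis G'_basis : groebner_basis tau' G' (toric_ideal (K := K) u).
Local Notation tau := (@block_order n N tau').

Lemma linear_relation_initial (i j : 'I_n) (l : 'I_r) (k k' : 'I_(s l)) :
  (i < j)%N ->
  initial_monomial tau (linear_relation K i j k k')
    (U_(x_index s i) + U_(T_index n k))%MM.
Proof.
move=> /ltmc_U ltij; rewrite linear_relationE.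
have [tau_total _ _ _ _] := block_order_monomial n tau'_order.
apply: initial_monomial_binomial => //; last first.
  by rewrite /block_order !block_fst_xT ltij.
apply: contraTneq ltij => /(congr1 (@block_fst n N)).
by rewrite !block_fst_xT => ->; rewrite ltxx.
Qed.

Lemma rees_basis_finite :
  exists S : seq {mpoly K[n + N]}, forall g, rees_basis u G' g <-> g \in S.
Proof.
have [[S' G'S'] _ _] := G'_basis.
(* The types of [k] and [k'] depend on [l]; a tagged pair packs all the indices into one finite type
   that can be enumerated. *)
pose syz (p : 'I_n * 'I_n * {l : 'I_r & ('I_(s l) * 'I_(s l))%type}) :=
  (p.1.1 < p.1.2)%N && (U_(p.1.1) + u (tagged p.2).1 ==
    U_(p.1.2) + u (tagged p.2).2)%MM.
pose lrel (p : 'I_n * 'I_n * {l : 'I_r & ('I_(s l) * 'I_(s l))%type}) :=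
  linear_relation K p.1.1 p.1.2 (tagged p.2).1 (tagged p.2).2.
exists ([seq lrel p | p <- enum syz] ++ [seq T_inclusion n g | g <- S']) => g.
rewrite mem_cat; split.
  case=> [[i [j [l [k [k' [[ltij e] ->]]]]]]|[g' /G'S' S'g' ->]].
    apply/orP; left; apply/mapP.
    exists (i, j, Tagged (fun l => 'I_(s l) * 'I_(s l))%type (k, k')) => //.
    by rewrite mem_enum unfold_in /syz /= ltij e eqxx.
  by apply/orP; right; apply: map_f.
case/orP=> /mapP[].
  move=> [[i j] [l [k k']]]; rewrite mem_enum unfold_in /syz /=.
  by move=> /andP[ltij /eqP e] ->; left; exists i, j, l, k, k'.
by move=> g' /G'S' G'g' ->; right; exists g'.
Qed.

Lemma rees_basis_sub g : rees_basis u G' g -> rees_ideal u g.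
Proof.
case=> [[i [j [l [k [k' [syz ->]]]]]]|[g' G'g' ->]].
  exact: linear_relation_rees.
have [_ G'_sub _] := G'_basis.
by rewrite /rees_ideal rees_map_T_inclusion; apply: G'_sub.
Qed.

Lemma rees_ideal_initial (f : {mpoly K[n + N]}) m :
  rees_ideal u f -> initial_monomial tau f m ->
  exists g k, [/\ rees_basis u G' g, initial_monomial tau g k & (k <= m)%MM].
Proof.
move=> f0 [fm m_max].
have [m' [fm' ne_m'm e]] := comp_mpoly_mnm_eq0 rees_map_tupleE f0 fm.
(* Maximality of [m] leaves two cases: a smaller x-part in [m'], which yields a linear relation, or
   equal x-parts, where [G'] takes over. *)
have /orP[lt_m'm|/andP[/eqP eq_fst le_snd]] := m_max m' fm'.
  have [i [j [l [k [k' [syz dvd]]]]]] := linear_relation_dvd e lt_m'm.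
  exists (linear_relation K i j k k'), (U_(x_index s i) + U_(T_index n k))%MM.
  split=> //; first by left; exists i, j, l, k, k'.
  by apply: linear_relation_initial; case: syz.
have [tau'_total _ _ _ _] := tau'_order.
have [_ _ eq_init] := G'_basis.
(* The common x-part cancels from the two equal images. This binomial replaces [f] as the element to
   which the hypothesis on [G'] applies. *)
have toric : toric_ideal u ('X_[block_snd m] - 'X_[block_snd m'] : {mpoly K[N]}).
  rewrite /toric_ideal /fiber_map comp_mpolyB !(comp_mpoly_mnm fiber_map_tupleE).
  by move: e; rewrite !rees_mnmE eq_fst => /addmI ->; rewrite subrr.
have ne_snd : block_snd m != block_snd m'.
  by apply: contra_neq ne_m'm => /esym; apply: block_eqP.
have init := initial_monomial_binomial K tau'_total ne_snd le_snd.
have /eq_init/initial_ideal_dvd[g [k [G'g gk le_k]]] :=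
  initial_ideal_mem toric init.
exists (T_inclusion n g), (mnm_snd n k); split.
- by right; exists g.
- exact: T_inclusion_initial.
- exact: lepm_trans (mnm_snd_le n le_k) (mnm_snd_block_snd m).
Qed.

End MultiReesExponents.

Theorem theorem3p2 (K : fieldType) (n r : nat)
    (I : 'I_r -> {mpoly K[n]} -> Prop) (s d : 'I_r -> nat)
    (u : forall i : 'I_r, 'I_(s i) -> 'X_{1..n})
    (I_stable : forall i, strongly_stable (I i))
    (u_gens : forall i, lists_minimal_generators (u i) (I i))
    (u_deg : forall (i : 'I_r) (j : 'I_(s i)), mdeg (u i j) = d i)
    (tau' : rel 'X_{1..\sum_(i < r) s i}) (tau'_order : monomial_order tau')
    (G' : {mpoly K[\sum_(i < r) s i]} -> Prop)
    (G'_basis : groebner_basis tau' G' (toric_ideal (K := K) u)) :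
  exists tau : rel 'X_{1..n + \sum_(i < r) s i},
    [/\ monomial_order tau,
        extends_order tau tau',
        forall (i j : 'I_n) (l : 'I_r) (k k' : 'I_(s l)),
          linear_syzygy u i j k k' ->
          initial_monomial tau (linear_relation K i j k k')
            (U_(x_index s i) + U_(T_index n k))%MM
      & groebner_basis tau (rees_basis u G') (rees_ideal (K := K) u)].
Proof.
exists (@block_order n _ tau'); split.
- exact: block_order_monomial.
- by move=> m1 m2; apply: block_order_snd.
- by move=> i j l k k' [ltij _]; apply: linear_relation_initial.
split=> [|g|q]; first exact: rees_basis_finite G'_basis.
  exact: rees_basis_sub G'_basis g.
(* One inclusion follows from the basis lying in the ideal; the other from divisibility of initial
   monomials. *)
split; last by apply: initial_ideal_mono => g; apply: rees_basis_sub G'_basis g.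
apply: initial_ideal_sub.
exact: (rees_ideal_initial u_deg I_stable u_gens tau'_order G'_basis).
Qed.
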